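(* Let $S=[0,2]^2$ and define $$v^{\mathrm{INT}}(b):=\min_{y\in\mathbb Z_{\ge0}^2}\{\mathbf 1^\top y:\ y\ge b\},\qquad b=(b_1,b_2)\in S.$$ Then $$v^{\mathrm{INT}}(b_1,b_2)=\lceil b_1\rceil+\lceil b_2\rceil\qquad\text{a.e. on }S.$$ There is no finite-valued convex function $\widetilde v$ on any open neighborhood of $S$ such that the residual $\varphi:=\widetilde v-v^{\mathrm{INT}}$ satisfies $$\bar\Pi_1\varphi=0\qquad\text{a.e. on }[0,2].$$ Consequently, exact all-axes slice-centering is impossible for this instance: there is no finite-valued convex $\widetilde v$ on an open neighborhood of $S$ for which $\bar\Pi_1\varphi=0$ and $\bar\Pi_2\varphi=0$ a.e. on $[0,2]$.
   Context: $\mathbf 1=(1,1)^\top$, the inequality $y\ge b$ is componentwise. For $\varphi\in L^1([0,2]^2)$ the slice-average profiles are $$(\bar\Pi_1\varphi)(b_2)=\frac12\int_0^2\varphi(t,b_2)\,dt,\qquad(\bar\Pi_2\varphi)(b_1)=\frac12\int_0^2\varphi(b_1,t)\,dt.$$ *)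

(* Defs.v *)
From HB Require Import structures.
From mathcomp Require Import all_boot all_order all_algebra.
From mathcomp Require Import all_classical all_reals all_analysis.

Set Implicit Arguments.
Unset Strict Implicit.
Unset Printing Implicit Defensive.

Import Order.TTheory GRing.Theory Num.Theory.
Import numFieldNormedType.Exports.

Local Open Scope classical_set_scope.
Local Open Scope ring_scope.

Definition square02 (R : realType) : set (R * R) := `[0, 2] `*` `[0, 2].
Arguments square02 : clear implicits.

Definition feasible (R : realType) (b : R * R) : set (nat * nat) :=
  [set y | b.1 <= y.1%:R /\ b.2 <= y.2%:R].

Definition feasible_values (R : realType) (b : R * R) : set R :=
  [set (y.1 + y.2)%:R | y in feasible b].

(* The infimum is attained, see [vINT_min]. *)
Definition vINT (R : realType) (b : R * R) : R := inf (feasible_values b).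

Lemma vINT_min (R : realType) (b : R * R) :
  feasible_values b (vINT b) /\ lbound (feasible_values b) (vINT b).
Proof.
have least (x : R) : exists k : nat,
    x <= k%:R /\ forall n : nat, x <= n%:R -> (k <= n)%N.
  have ex : exists n : nat, x <= n%:R.
    by exists (Num.bound `|x|); rewrite (le_trans (ler_norm x))// ltW// archi_boundP.
  by case: (ex_minnP ex) => k xk kmin; exists k.
have [k1 [bk1 min1]] := least b.1.
have [k2 [bk2 min2]] := least b.2.
have lb : lbound (feasible_values b) (k1 + k2)%:R.
  by move=> _ [y [y1 y2] <-]; rewrite ler_nat leq_add ?min1 ?min2.
have mem : feasible_values b (k1 + k2)%:R by exists (k1, k2).
suff -> : vINT b = (k1 + k2)%:R by [].
apply/le_anti/andP; split.
- by apply: ge_inf mem; exists (k1 + k2)%:R.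
- by apply: lb_le_inf lb; exists (k1 + k2)%:R.
Qed.

(* [U] need not be convex: [v] is required to be convex on each convex subset
   of [U].  When [U] is convex this is convexity of [v] on [U]. *)
Definition convex_on (R : realType) (U : set (R * R)) (v : R * R -> R) : Prop :=
  forall C : set (convex_lmodType (R^o * R^o)%type),
    C `<=` U -> convex_set C -> convex_function C v.

Definition residual (R : realType) (v : R * R -> R) : R * R -> R :=
  fun b => v b - vINT b.

(* The profiles take values in [\bar R], so that a divergent integral is not
   silently replaced by [0]. *)
Definition slice_avg1 (R : realType) (phi : R * R -> R) (b2 : R) : \bar R :=
  ((2^-1)%:E * \int[lebesgue_measure]_(t in `[0%R, 2%R]) (phi (t, b2))%:E)%E.

Definition slice_avg2 (R : realType) (phi : R * R -> R) (b1 : R) : \bar R :=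
  ((2^-1)%:E * \int[lebesgue_measure]_(t in `[0%R, 2%R]) (phi (b1, t))%:E)%E.

Definition ae_zero02 (R : realType) (g : R -> \bar R) : Prop :=
  {ae lebesgue_measure, forall x : R, `[0, 2]%classic x -> g x = 0%E}.

(* Main.v *)
Require Import Defs.
From mathcomp Require Import all_boot all_order all_algebra.
From mathcomp Require Import all_classical all_reals all_analysis.
From mathcomp Require Import ring lra.
Import Order.TTheory GRing.Theory Num.Theory.
Import numFieldNormedType.Exports.
Local Open Scope classical_set_scope.
Local Open Scope ring_scope.

(** A convex [v] has convex slice averages, whereas the slice averages of [vINT]
    jump: they are [3/2 + ceil c] at height [c], a step function equal to [5/2]
    on [(0, 1]] and to [7/2] on [(1, 2]].  An upward step cannot agree almost
    everywhere with a convex function: if [b] lies strictly between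
    [a <= 1] and [c], and [1 < b < c <= 2], the step takes its upper value
    at [b] and lies strictly below it on average over [a] and [c].

    The comparison is made before integrating.  For such [a, b, c], with
    [0 < a] and [b = t * a + (1 - t) * c], convexity of [v] along each vertical
    segment gives
    [residual v (s, b) <= t * residual v (s, a) + (1 - t) * residual v (s, c) - t]
    for every [s] in [[0, 2]] ([residual_jensen]).  If the three averages vanish,
    integrating in [s] yields [0 <= - 2 * t], although [t > 0]
    ([residual_slices_nonzero]), and a set of full measure contains such heights
    ([ae_exists_itvoo]).  The integration is legitimate because a convex function
    on a compact interval is bounded and its sublevel sets are intervals, so that
    it is integrable ([convex_itv_integrable]). *)

(** * The value function *)

Lemma vINT_ceil (R : realType) (b : R * R) : 0 <= b.1 -> 0 <= b.2 ->
  vINT b = (Num.ceil b.1 + Num.ceil b.2)%:~R.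
Proof.
move=> b1 b2; have [[y [y1 y2] yE] lb] := vINT_min b.
have ceil_nat (x : R) : 0 <= x -> `|Num.ceil x|%N%:R = (Num.ceil x)%:~R :> R.
  by move=> x0; rewrite natr_absz ger0_norm// ceil_ge0 (lt_le_trans _ x0)// ltrN10.
apply/le_anti/andP; split.
  apply: lb; exists (`|Num.ceil b.1|%N, `|Num.ceil b.2|%N).
    by rewrite /feasible/= !ceil_nat// !ceil_ge.
  by rewrite natrD !ceil_nat// rmorphD.
have ceil_le (x : R) (n : nat) : x <= n%:R -> (Num.ceil x)%:~R <= n%:R :> R.
  by move=> xn; rewrite -[n%:R]/((n%:Z)%:~R) ler_int ceil_le_int.
by rewrite -yE natrD rmorphD/= lerD// ceil_le.
Qed.

(** * Integrability of convex functions on a compact interval *)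

Lemma lebesgue_measure_itvcc_lty (R : realType) (a b : R) :
  (lebesgue_measure (`[a, b]%classic : set R) < +oo)%E.
Proof.
by rewrite lebesgue_measure_itv/=; case: ifP => // _; rewrite -EFinD ltry.
Qed.

Section convex_itv.
Context {R : realType} (a b : R) (f : R -> R).
Hypothesis cf : @convex_function R R^o `[a, b] f.

Let convex_itv (t x y : R) : 0 <= t <= 1 -> x \in `[a, b] -> y \in `[a, b] ->
  f (t * x + (1 - t) * y) <= t * f x + (1 - t) * f y.
Proof.
move=> /andP[t0 t1] xab yab.
have := cf (Itv01 t0 t1) x y; rewrite !inE => /(_ xab yab).
by rewrite convRE.
Qed.

(** The sublevel sets are intervals. *)
Lemma convex_itv_measurable : measurable_fun `[a, b] f.
Proof.
apply: (measurability (@measurable_realfun.RGenInftyO.G R)) => [|/= _ [_] [r] -> <-].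
  exact: measurable_realfun.RGenInftyO.measurableE.
apply: measurable_realfun.is_interval_measurable => x y [xab/=].
rewrite !in_itv/= => xr [yab yr] z /andP[xz zy]; split.
  move: xab yab; rewrite /= !in_itv/= => /andP[ax _] /andP[_ yb].
  by rewrite (le_trans ax)// (le_trans zy).
have [xy|yx] := ltP x y; last first.
  have -> // : z = x by apply/le_anti; rewrite xz (le_trans zy).
rewrite /= in_itv/=.
have yx0 : y - x != 0 by rewrite subr_eq0 gt_eqF.
pose t := (y - z) / (y - x).
have t0 : 0 <= t by rewrite divr_ge0// subr_ge0// ltW.
have t1 : t <= 1 by rewrite ler_pdivrMr ?subr_gt0// mul1r lerD2l lerN2.
have -> : z = t * x + (1 - t) * y by rewrite /t; field.
apply: (le_lt_trans (convex_itv _ _ _ _ xab yab)); first by rewrite t0.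
rewrite -subr_gt0 (_ : _ - _ = t * (r - f x) + (1 - t) * (r - f y)); last by ring.
have [->|t_neq0] := eqVneq t 0; first by rewrite mul0r add0r subr0 mul1r subr_gt0.
rewrite ltr_wpDr//; first by rewrite mulr_ge0// subr_ge0 // ltW.
by rewrite mulr_gt0 ?subr_gt0// lt_neqAle eq_sym t_neq0.
Qed.

(** Above, [f] stays below its chord.  Below, reflecting [x] about the midpoint
    [m] gives [2 * f m <= f x + f (a + b - x)], where the last term is already
    bounded above. *)
Lemma convex_itv_bounded : exists M, forall x, x \in `[a, b] -> `|f x| <= M.
Proof.
have [ab|ba] := leP a b; last first.
  by exists 0 => x; rewrite in_itv/= => /andP[ax /(le_trans ax)]; rewrite leNgt ba.
pose N := `|f a| + `|f b|.
have aab : a \in `[a, b] by rewrite in_itv/= lexx.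
have bab : b \in `[a, b] by rewrite in_itv/= lexx ab.
have ub x : x \in `[a, b] -> f x <= N.
  move=> xab; have [ab'|ba] := ltP a b; last first.
    have -> : x = a by move: xab; rewrite in_itv/= => xab; apply/le_anti; lra.
    by rewrite (le_trans (ler_norm _))// lerDl.
  have ba0 : b - a != 0 by rewrite subr_eq0 gt_eqF.
  pose t := (b - x) / (b - a).
  move: xab; rewrite in_itv/= => /andP[ax xb].
  have t0 : 0 <= t by rewrite divr_ge0// subr_ge0// ltW.
  have t1 : t <= 1 by rewrite ler_pdivrMr ?subr_gt0// mul1r lerD2l lerN2.
  have -> : x = t * a + (1 - t) * b by rewrite /t; field.
  apply: (le_trans (convex_itv _ _ _ _ aab bab)); first by rewrite t0.
  rewrite lerD//.
    apply: (le_trans (ler_norm _)).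
    by rewrite normrM ger0_norm// ler_piMl.
  apply: (le_trans (ler_norm _)).
  by rewrite normrM ger0_norm ?subr_ge0// ler_piMl// gerBl.
pose m := (a + b) / 2; exists (N + 2 * `|f m|) => x xab.
have xab' : a + b - x \in `[a, b] by move: xab; rewrite !in_itv/= => xab; lra.
have := ub _ xab; have := ub _ xab'.
have := convex_itv (2^-1) x (a + b - x) _ xab xab'.
have -> : 2^-1 * x + (1 - 2^-1) * (a + b - x) = m by rewrite /m; field.
move=> /(_ ltac:(lra)) h1 h2 h3.
have := ler_norm (- f m); rewrite normrN => h4.
have := normr_ge0 (f m).
by move=> h5; rewrite ler_norml; apply/andP; split; lra.
Qed.

Lemma convex_itv_integrable :
  (lebesgue_measure).-integrable `[a, b] (EFin \o f).
Proof.
apply: measurable_bounded_integrable => //.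
- exact: lebesgue_measure_itvcc_lty.
- exact convex_itv_measurable.
- have [M fM] := convex_itv_bounded.
  by exists M; split; rewrite ?num_real// => N MN x /= xab;
    rewrite (le_trans (fM _ xab))// ltW.
Qed.

End convex_itv.

(** * Measure-theoretic preliminaries *)

Lemma ceil_integrable (R : realType) (a b : R) :
  (lebesgue_measure).-integrable `[a, b] (EFin \o (fun t : R => (Num.ceil t)%:~R)).
Proof.
have nd : {homo (fun t : R => (Num.ceil t)%:~R : R) : x y / x <= y}.
  by move=> x y xy; rewrite ler_int le_ceil.
apply: measurable_bounded_integrable => //.
- exact: lebesgue_measure_itvcc_lty.
- exact (measurable_realfun.nondecreasing_measurable (measurable_itv _) nd).
- exists (`|(Num.ceil a)%:~R| + `|(Num.ceil b)%:~R|); split; rewrite ?num_real// => N MN x /=.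
  rewrite in_itv/= => /andP[/nd/= ax /nd/= xb]; apply/ltW/(le_lt_trans _ MN).
  have := ler_norm ((Num.ceil b)%:~R : R).
  have := ler_norm (- (Num.ceil a)%:~R : R); rewrite normrN.
  have := normr_ge0 ((Num.ceil a)%:~R : R); have := normr_ge0 ((Num.ceil b)%:~R : R).
  by move=> *; rewrite ler_norml; apply/andP; split; lra.
Qed.

Lemma ae_exists_itvoo (R : realType) (P : R -> Prop) (x y : R) : x < y ->
  {ae lebesgue_measure, forall z : R, P z} -> exists2 z, z \in `]x, y[ & P z.
Proof.
move=> xy aeP; apply: contrapT => noP.
have : lebesgue_measure.-negligible (`]x, y[%classic : set (measurableTypeR R)).
  apply: negligibleS aeP => z /= zxy Pz; apply: noP; by exists z.
move=> neg; have : lebesgue_measure (`]x, y[%classic : set R) = 0%E.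
  by apply: (measure_negligible _ neg); exact: measurable_itv.
rewrite lebesgue_measure_itv/= lte_fin xy -EFinB => /eqP.
by rewrite eqe subr_eq0 gt_eqF.
Qed.

(** Stated over an arbitrary measurable space: the display that the real line
    carries in [lebesgue_measure] differs from the default one on [R], and the
    linearity lemmas would have to unify the two. *)
Lemma le_Rintegral_conv d (T : measurableType d) (R : realType)
    (mu : {measure set T -> \bar R}) (D : set T) (f g h : T -> R) (t k : R) :
  measurable D -> (mu D < +oo)%E ->
  mu.-integrable D (EFin \o f) -> mu.-integrable D (EFin \o g) ->
  mu.-integrable D (EFin \o h) ->
  (forall x, D x -> h x <= t * f x + (1 - t) * g x - k) ->
  \int[mu]_(x in D) h x <=
    t * \int[mu]_(x in D) f x + (1 - t) * \int[mu]_(x in D) g x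
    - k * fine (mu D).
Proof.
move=> mD fD fi gi hi le_h.
have tfi : mu.-integrable D (EFin \o (fun x => t * f x)).
  exact (integrableZl mD t fi).
have tgi : mu.-integrable D (EFin \o (fun x => (1 - t) * g x)).
  exact (integrableZl mD (1 - t) gi).
have fgi : mu.-integrable D (EFin \o (fun x => t * f x + (1 - t) * g x)).
  exact (integrableD mD tfi tgi).
have ki : mu.-integrable D (EFin \o (fun=> k)).
  by apply: measurable_bounded_integrable => //; exact: bounded_cst.
rewrite -RintegralZl// -RintegralZl// -RintegralD// -Rintegral_cst//.
rewrite -RintegralB//; apply: le_Rintegral => //.
exact (integrableB mD fgi ki).
Qed.

(** * Slices of the residual *)

Section slices.
Context {R : realType} (v : R * R -> R).
Hypothesis cv : @convex_function R (R^o * R^o)%type (square02 R) v.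

Let square_convex (t x1 x2 y1 y2 : R) : 0 <= t <= 1 ->
  x1 \in `[0, 2] -> x2 \in `[0, 2] -> y1 \in `[0, 2] -> y2 \in `[0, 2] ->
  v (t * x1 + (1 - t) * y1, t * x2 + (1 - t) * y2) <=
    t * v (x1, x2) + (1 - t) * v (y1, y2).
Proof.
move=> /andP[t0 t1] x102 x202 y102 y202.
by apply: (cv (Itv01 t0 t1) (x1, x2) (y1, y2)); rewrite inE; split.
Qed.

Lemma slice_convex (c : R) : c \in `[0, 2] ->
  @convex_function R R^o `[0, 2] (fun t => v (t, c)).
Proof.
move=> c02 t x y; rewrite !inE => x02 y02.
rewrite !convRE.
have {1}-> : c = t%:num * c + (1 - t%:num) * c by ring.
apply: square_convex => //; apply/andP; split; [exact: ge0|exact: le1].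
Qed.

Lemma residual_slice_integrable (c : R) : c \in `[0, 2] ->
  (lebesgue_measure).-integrable `[0, 2] (EFin \o (fun t => residual v (t, c))).
Proof.
move=> c02; have /andP[c0 _] : 0 <= c <= 2 by rewrite in_itv in c02.
have iv := convex_itv_integrable _ _ _ (slice_convex c c02).
have ic := ceil_integrable R 0 2.
have ik : (lebesgue_measure).-integrable `[0, 2]
    (EFin \o (fun=> (Num.ceil c)%:~R : R)).
  apply: measurable_bounded_integrable => //.
  - exact: lebesgue_measure_itvcc_lty.
  - exact: bounded_cst.
apply: eq_integrable (integrableB _ (integrableB _ iv ic) ik) => //.
move=> t; rewrite inE/= in_itv/= => /andP[t0 _].
by rewrite -!EFinB /residual vINT_ceil//= rmorphD/= opprD addrA.
Qed.

(** The gap [- t] is the jump of [ceil] at [1]: [ceil a = 1], whereas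
    [ceil = 2] both at [c] and at the combination. *)
Lemma residual_jensen (s t a c : R) : 0 <= t <= 1 -> s \in `[0, 2] ->
  0 < a <= 1 -> 1 < t * a + (1 - t) * c -> 1 < c <= 2 ->
  residual v (s, t * a + (1 - t) * c) <=
    t * residual v (s, a) + (1 - t) * residual v (s, c) - t.
Proof.
move=> t01 s02 a01 b1 c12; move: (t01) => /andP[t0 t1].
have b2 : t * a + (1 - t) * c <= 2 by nra.
have ceil1 : Num.ceil a = 1 by apply: ceil_def; rewrite subrr.
have ceil2 (x : R) : 1 < x <= 2 -> Num.ceil x = 2.
  by move=> x12; apply: ceil_def.
have := @square_convex t s a s c t01 s02 _ s02.
have -> : t * s + (1 - t) * s = s by ring.
rewrite !in_itv/= => /(_ ltac:(lra) ltac:(lra)).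
have s0 : 0 <= s by move: s02; rewrite in_itv/= => /andP[].
rewrite /residual !vINT_ceil//=; try lra.
rewrite !rmorphD/= ceil1 (ceil2 c)// (ceil2 (_ + _)) ?b1//.
lra.
Qed.

Lemma residual_slices_nonzero (a b c : R) : 0 < a <= 1 -> 1 < b -> b < c <= 2 ->
  slice_avg1 (residual v) a = 0%E -> slice_avg1 (residual v) b = 0%E ->
  slice_avg1 (residual v) c = 0%E -> False.
Proof.
move=> a01 b1 bc2.
have avg0 x : slice_avg1 (residual v) x = 0%E ->
    \int[lebesgue_measure]_(s in `[0, 2]) residual v (s, x) = 0.
  move/eqP; rewrite mule_eq0 eqe invr_eq0 pnatr_eq0/= => /eqP.
  by rewrite /Rintegral => ->.
move=> /avg0 a0 /avg0 b0 /avg0 c0.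
have ca : c - a != 0 by rewrite subr_eq0 gt_eqF//; lra.
pose t := (c - b) / (c - a).
have t0 : 0 < t by rewrite divr_gt0//; lra.
have t1 : t <= 1 by rewrite ler_pdivrMr; lra.
have bE : b = t * a + (1 - t) * c by rewrite /t; field.
have i02 (x : R) : 0 <= x <= 2 ->
    (lebesgue_measure).-integrable `[0, 2] (EFin \o (fun s => residual v (s, x))).
  by move=> x02; apply: residual_slice_integrable; rewrite in_itv.
have ia := i02 a ltac:(lra); have ib := i02 b ltac:(lra).
have ic := i02 c ltac:(lra).
have jensen s : `[0, 2]%classic s -> residual v (s, b) <=
    t * residual v (s, a) + (1 - t) * residual v (s, c) - t.
  by move=> s02; rewrite bE; apply: residual_jensen; rewrite -?bE//; lra.
have := le_Rintegral_conv _ _ _ lebesgue_measure _ _ _ _ t t (measurable_itv _)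
  (lebesgue_measure_itvcc_lty R 0 2) ia ic ib jensen.
have m2 : fine (lebesgue_measure (`[0, 2]%classic : set R)) = 2.
  by rewrite lebesgue_measure_itv/= lte_fin ltr0n -EFinB subr0.
rewrite a0 b0 c0 [fine _]m2.
lra.
Qed.

End slices.

(** * Impossibility of centering *)

(** A centering along both axes is in particular a centering along the first, so
    the last claim follows from the second one; the formula for [vINT] holds at
    every point of the square. *)
Theorem propositionC1 (R : realType) :
  [/\ {ae (lebesgue_measure \x lebesgue_measure)%E, forall b : R * R,
        square02 R b -> vINT b = (Num.ceil b.1 + Num.ceil b.2)%:~R},
      ~ (exists (U : set (R * R)) (v : R * R -> R),
          [/\ open U, square02 R `<=` U, convex_on U v
            & ae_zero02 (slice_avg1 (residual v))])
    & ~ (exists (U : set (R * R)) (v : R * R -> R),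
          [/\ open U, square02 R `<=` U, convex_on U v,
              ae_zero02 (slice_avg1 (residual v))
            & ae_zero02 (slice_avg2 (residual v))])].
Proof.
have nocenter1 : ~ (exists (U : set (R * R)) (v : R * R -> R),
    [/\ open U, square02 R `<=` U, convex_on U v
      & ae_zero02 (slice_avg1 (residual v))]).
  move=> [U [v [_ SU vcvx v0]]].
  have cS : @convex_set R (R^o * R^o)%type (square02 R).
    move=> [x1 x2] [y1 y2] t; rewrite !inE => -[/= x1S x2S] [/= y1S y2S].
    have t0 : 0 <= t%:num :> R by exact: ge0.
    have t1 : t%:num <= 1 :> R by exact: le1.
    have conv02 (x y : R) : x \in `[0, 2] -> y \in `[0, 2] ->
        t%:num * x + (1 - t%:num) * y \in `[0, 2].
      by rewrite !in_itv/= => x02 y02; apply/andP; split; nra.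
    by split; apply: conv02.
  have cv := vcvx _ SU cS.
  have null_slice (x y : R) : 0 <= x -> x < y -> y <= 2 ->
      exists2 z, x < z < y & slice_avg1 (residual v) z = 0%E.
    move=> x0 xy y2; have [z] := ae_exists_itvoo _ _ _ _ xy v0.
    rewrite in_itv/= => /andP[xz zy]; rewrite in_itv/= => avg_z.
    by exists z; [rewrite xz|apply: avg_z; lra].
  have [a a01 a0] : exists2 a, 0 < a < 1 & slice_avg1 (residual v) a = 0%E.
    by apply: null_slice; lra.
  have [b b12 b0] : exists2 b, 1 < b < 3 / 2 & slice_avg1 (residual v) b = 0%E.
    by apply: null_slice; lra.
  have [c c12 c0] : exists2 c, 3 / 2 < c < 2 & slice_avg1 (residual v) c = 0%E.
    by apply: null_slice; lra.
  have [a01' b1 bc2] : [/\ 0 < a <= 1, 1 < b & b < c <= 2].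
    by clear -a01 b12 c12; split; lra.
  exact: (residual_slices_nonzero v cv a b c).
split => //.
- apply: aeW => -[b1 b2] [/=]; rewrite !in_itv/= => /andP[b10 _] /andP[b20 _].
  exact: vINT_ceil.
- move=> [U [v [oU SU cv v1 _]]]; apply: nocenter1; by exists U, v.
Qed.
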